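(* The mesh patterns $\mathrm{Nr.23}=(12,\{(0,0),(0,2),(1,0),(1,1),(1,2)\})$ and $\mathrm{Nr.24}=(12,\{(0,0),(0,1),(1,0),(1,1),(1,2)\})$ are equidistributed: for every $n\ge1$ and every integer $m\ge0$, the number of $\pi\in S_n$ with $\mathrm{Nr.23}(\pi)=m$ equals the number of $\pi\in S_n$ with $\mathrm{Nr.24}(\pi)=m$.
   Context: $S_n$ is the set of permutations of $\{1,\dots,n\}$ in one-line notation. A mesh pattern of length $k$ is a pair $(\tau,R)$ with $\tau\in S_k$ and $R\subseteq\{0,\dots,k\}\times\{0,\dots,k\}$ (the set of shaded boxes). An occurrence of $(\tau,R)$ in $\pi\in S_n$ is a choice of positions $a_1<\cdots<a_k$ such that $\pi(a_1)\cdots\pi(a_k)$ is order-isomorphic to $\tau$ and, writing $v_1<\cdots<v_k$ for the values $\pi(a_1),\dots,\pi(a_k)$ sorted increasingly and $a_0=v_0=0$, $a_{k+1}=v_{k+1}=n+1$, for every $(i,j)\in R$ there is no position $c$ with $a_i<c<a_{i+1}$ and $v_j<\pi(c)<v_{j+1}$. For a mesh pattern $p$, $p(\pi)$ denotes the number of occurrences of $p$ in $\pi$. *)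

(* Defs.v *)
From mathcomp Require Import all_boot all_fingroup.

Set Implicit Arguments.
Unset Strict Implicit.
Unset Printing Implicit Defensive.

(* The sets {1, ..., n} of positions and values are represented by
   'I_n = {0, ..., n-1}: the element x : 'I_n stands for x.+1. *)

(* A pair (tau, R): underlying permutation and set of shaded boxes. *)
Definition mesh_pattern (k : nat) : finType :=
  ('S_k * {set 'I_k.+1 * 'I_k.+1})%type.

Section Mesh.

Variables (k n : nat) (p : mesh_pattern k) (pi : 'S_n).

(* The sequence 0 = a_0, a_1, ..., a_k, a_{k+1} = n + 1. *)
Definition mesh_pos (a : k.-tuple 'I_n) : seq nat :=
  0 :: rcons [seq (x : 'I_n).+1 | x <- a] n.+1.

(* The sequence 0 = v_0, v_1 < ... < v_k, v_{k+1} = n + 1. *)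
Definition mesh_val (a : k.-tuple 'I_n) : seq nat :=
  0 :: rcons (sort leq [seq (pi x).+1 | x <- a]) n.+1.

Definition in_box (a : k.-tuple 'I_n) (b : 'I_k.+1 * 'I_k.+1) (c : 'I_n) : bool :=
  (nth 0 (mesh_pos a) b.1 < c.+1 < nth 0 (mesh_pos a) b.1.+1) &&
  (nth 0 (mesh_val a) b.2 < (pi c).+1 < nth 0 (mesh_val a) b.2.+1).

Definition mesh_occurrence (a : k.-tuple 'I_n) : bool :=
  [&& [forall i : 'I_k, forall j : 'I_k, (i < j) ==> (tnth a i < tnth a j)],
      [forall i : 'I_k, forall j : 'I_k,
         (pi (tnth a i) < pi (tnth a j)) == (p.1 i < p.1 j)] &
      [forall b in p.2, forall c : 'I_n, ~~ in_box a b c]].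

Definition mesh_count : nat := #|[set a : k.-tuple 'I_n | mesh_occurrence a]|.

End Mesh.

Definition boxes (k : nat) (s : seq (nat * nat)) : {set 'I_k.+1 * 'I_k.+1} :=
  [set b : 'I_k.+1 * 'I_k.+1 | (b.1 : nat, b.2 : nat) \in s].

(* The permutation 12 is the identity of 'S_2. *)
Definition Nr23 : mesh_pattern 2 :=
  (1%g : 'S_2, boxes 2 [:: (0, 0); (0, 2); (1, 0); (1, 1); (1, 2)]).

Definition Nr24 : mesh_pattern 2 :=
  (1%g : 'S_2, boxes 2 [:: (0, 0); (0, 1); (1, 0); (1, 1); (1, 2)]).

(* Main.v *)
(* The insertion code e of pi, where e j counts the c < j with pi c < pi j,
   ranges bijectively over the sequences with 0 <= e j <= j. Occurrences of
   Nr23 are the adjacent pairs (i, i+1) with e i = 0 and e (i+1) = i+1;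
   occurrences of Nr24 are those with e i = 0 and e (i+1) = 1. Exchanging the
   values 1 and j at each index j > 0 of the code preserves its zeros and turns
   one statistic into the other. *)
Require Import Defs.
From mathcomp Require Import all_boot all_fingroup.
From mathcomp Require Import zify.

Set Implicit Arguments.
Unset Strict Implicit.
Unset Printing Implicit Defensive.

(** * The insertion code as a bijection from permutations to bounded sequences *)

Section Code.

Variable n : nat.
Implicit Types (pi sigma : 'S_n) (e : {ffun 'I_n -> 'I_n}).

Definition smaller_before pi (j : 'I_n) : {set 'I_n} :=
  [set c : 'I_n | (c < j) && (pi c < pi j)].

Lemma card_ord_lt (j : 'I_n) : #|[set c : 'I_n | c < j]| = j.
Proof.
have lejn : j <= n := ltnW (ltn_ord j).
have -> : [set c : 'I_n | c < j] = [set widen_ord lejn k | k : 'I_j].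
  apply/setP=> c; rewrite inE; apply/idP/imsetP => [ltcj | [k _ ->]] /=.
    by exists (Ordinal ltcj) => //; apply: val_inj.
  exact: ltn_ord.
by rewrite card_imset ?card_ord //; move=> k l [] /val_inj.
Qed.

Lemma card_smaller_before pi j : #|smaller_before pi j| <= j.
Proof.
rewrite -[X in _ <= X]card_ord_lt; apply: subset_leq_card.
by apply/subsetP=> c; rewrite !inE => /andP[].
Qed.

Definition code pi : {ffun 'I_n -> 'I_n} :=
  [ffun j => Ordinal (leq_ltn_trans (card_smaller_before pi j) (ltn_ord j))].

Lemma codeE pi j : code pi j = #|smaller_before pi j| :> nat.
Proof. by rewrite ffunE. Qed.

Lemma perm_card_lt pi i : pi i = #|[set c | pi c < pi i]| :> nat.
Proof.
rewrite -[LHS]card_ord_lt -[LHS](card_imset _ (@perm_inj _ pi^-1%g)).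
apply: eq_card => c; rewrite [RHS]inE; apply/imsetP/idP => [[d] | lt_ci].
  by rewrite inE => lt_di ->; rewrite permKV.
by exists (pi c); rewrite ?inE ?permK.
Qed.

Lemma perm_val_neq pi (c d : 'I_n) : c != d -> (pi c : nat) != pi d.
Proof. by rewrite val_eqE (inj_eq perm_inj). Qed.

(** By [perm_card_lt] a value is its rank, so the comparisons determine the permutation; the pairs
    with [c > d] follow because distinct positions carry distinct values. *)
Lemma perm_order_inj pi sigma :
  (forall c d : 'I_n, c < d -> (pi c < pi d) = (sigma c < sigma d)) ->
  pi = sigma.
Proof.
move=> eq_order; apply/permP => i; apply: val_inj.
rewrite /= [LHS]perm_card_lt [RHS]perm_card_lt; apply: eq_card => c; rewrite !inE.
have [/eq_order // | ltic | /val_inj ->] := ltngtP c i; last by rewrite !ltnn.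
have neq_ci : c != i by rewrite -val_eqE gtn_eqF.
have := eq_order _ _ ltic.
by have := perm_val_neq pi neq_ci; have := perm_val_neq sigma neq_ci; lia.
Qed.

(** By induction on the larger index, the code fixes the relative order of any two values: once the
    order on the indices below [j] is known, the number of them with a value below that at [j]
    places [j] in this order. *)
Lemma code_inj : injective code.
Proof.
move=> pi sigma eq_code; apply: perm_order_inj => c d ltcd.
suff IH (m : nat) : forall i j : 'I_n, i < j -> j < m ->
    (pi i < pi j) = (sigma i < sigma j) by exact: (IH d.+1).
elim: m => // m IHm i j ltij; rewrite ltnS => lejm.
have eq_before (x y : 'I_n) : x < j -> y < j ->
    (pi x < pi y) = (sigma x < sigma y).
  move=> ltxj ltyj.
  have [ltxy | ltyx | /val_inj ->] := ltngtP x y; last by rewrite !ltnn.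
    by apply: IHm => //; lia.
  have neq_yx : y != x by rewrite -val_eqE ltn_eqF.
  have := IHm _ _ ltyx (leq_trans ltxj lejm).
  by have := perm_val_neq pi neq_yx; have := perm_val_neq sigma neq_yx; lia.
set A := smaller_before pi j; set B := smaller_before sigma j.
have eq_card_AB : #|A| = #|B| by rewrite -!codeE eq_code.
(* Both sets are initial segments of the common order on the indices < j. *)
have eqAB : A = B.
  have [sAB | /subsetPn[x Ax nBx]] := boolP (A \subset B).
    by apply/eqP; rewrite eqEcard sAB eq_card_AB leqnn.
  apply/esym/eqP; rewrite eqEcard eq_card_AB leqnn andbT.
  (* A missing [y] would give [pi x < pi j <= pi y] and [sigma y < sigma j <= sigma x], against the
     common order of [x] and [y]. *)
  apply/subsetP=> y By; apply: contraT => nAy.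
  move: Ax nBx By nAy; rewrite !inE => /andP[ltxj lt_pi_xj].
  rewrite ltxj /= -leqNgt => le_sigma_jx /andP[ltyj lt_sigma_yj].
  rewrite ltyj /= -leqNgt => le_pi_jy.
  by have := eq_before x y ltxj ltyj; lia.
by move/setP/(_ i): eqAB; rewrite !inE ltij.
Qed.

Definition codes := family (fun j : 'I_n => [pred x : 'I_n | x <= j]).

Lemma card_codes : #|codes| = n`!.
Proof.
rewrite card_family foldrE big_map fact_prod big_add1 /= big_mkord big_enum /=.
apply: eq_bigr => j _.
have ltjn := ltn_ord j.
have -> : j.+1 = #|[set widen_ord ltjn k | k : 'I_j.+1]|.
  by rewrite card_imset ?card_ord //; move=> k l [] /val_inj.
apply: eq_card => c; apply/idP/imsetP => [lecj | [k _ ->]] /=.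
  by exists (Ordinal (lecj : c < j.+1)) => //; apply: val_inj.
exact: (ltn_ord k).
Qed.

(** Surjectivity comes from counting: an injective image of [n]! permutations lies inside a family
    of [n]! sequences. *)
Lemma code_image : code @: [set: 'S_n] = [set e in codes].
Proof.
apply/eqP; rewrite eqEcard; apply/andP; split.
  apply/subsetP=> _ /imsetP[pi _ ->]; rewrite inE.
  by apply/familyP=> j; rewrite /= inE codeE card_smaller_before.
rewrite (card_imset _ code_inj) cardsT card_Sn cardsE.
by rewrite card_codes.
Qed.

Lemma card_code_preim (P : pred {ffun 'I_n -> 'I_n}) :
  #|[set pi | P (code pi)]| = #|[set e in codes | P e]|.
Proof.
rewrite -(card_imset _ code_inj); apply: eq_card => e.
rewrite inE; have := code_image; move/setP/(_ e); rewrite inE => <-.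
apply/imsetP/andP => [[pi] | [/imsetP[pi _ ->] Ppi]].
  by rewrite inE => Ppi ->; split=> //; apply: imset_f.
by exists pi; rewrite ?inE.
Qed.

(** * The involution on codes and the statistics it exchanges *)

(** This is 1 for [j > 0] and 0 for [j = 0], so that it always fits in ['I_n] and the transposition
    at index 0 is trivial. *)
Definition cap1 (j : 'I_n) : 'I_n :=
  Ordinal (leq_ltn_trans (geq_minr 1 j) (ltn_ord j)).

Definition swap_code e : {ffun 'I_n -> 'I_n} :=
  [ffun j => tperm j (cap1 j) (e j)].

Lemma swap_codeK : involutive swap_code.
Proof. by move=> e; apply/ffunP=> j; rewrite !ffunE tpermK. Qed.

Lemma swap_code_codes e : (swap_code e \in codes) = (e \in codes).
Proof.
have swap_sub f : f \in codes -> swap_code f \in codes.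
  move=> /familyP cf; apply/familyP=> j; have := cf j; rewrite /= !inE ffunE.
  by case: tpermP => //= _ _; rewrite geq_minr.
by apply/idP/idP => /swap_sub; rewrite ?swap_codeK.
Qed.

(** The transposed values [j] and [cap1 j] are both nonzero when [j > 0] and coincide when [j = 0],
    so 0 is fixed. *)
Lemma swap_code_eq0 e j : (swap_code e j == 0 :> nat) = (e j == 0 :> nat).
Proof.
rewrite ffunE; case: tpermP => [-> | -> | //] /=; lia.
Qed.

Lemma swap_code_eq1 e (j : 'I_n) : 0 < j ->
  (swap_code e j == 1 :> nat) = (e j == j :> nat).
Proof.
move=> j_gt0; have <- : cap1 j = 1 :> nat by rewrite /=; lia.
by rewrite ffunE !val_eqE -{2}(tpermL j (cap1 j)) (inj_eq perm_inj).
Qed.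

(** The second positions of the occurrences, read on the code: [t] is the identity for [Nr23] and
    the constant 1 for [Nr24]. *)
Definition records (t : nat -> nat) e : {set 'I_n} :=
  [set j : 'I_n | [exists i : 'I_n,
    [&& i.+1 == j, e i == 0 :> nat & e j == t j :> nat]]].

Lemma records_swap_code e : records (fun=> 1) (swap_code e) = records id e.
Proof.
apply/setP=> j; rewrite !inE; apply: eq_existsb => i.
case: eqP => //= ij; rewrite swap_code_eq0 swap_code_eq1 //.
by rewrite -ij.
Qed.

(** * Extreme code entries: left-to-right minima (entry 0) and maxima (entry [j]) *)

Lemma code_eq0P pi (i : 'I_n) :
  reflect (forall c : 'I_n, c < i -> pi i < pi c) (code pi i == 0 :> nat).
Proof.
rewrite codeE cards_eq0; apply: (iffP eqP) => [Z c ltci | min_i].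
  have /setP/(_ c) := Z; rewrite !inE ltci /=.
  have := @perm_val_neq pi c i; rewrite -val_eqE ltn_eqF //= => /(_ isT); lia.
by apply/setP=> c; rewrite !inE; apply/negP => /andP[/min_i]; lia.
Qed.

Lemma code_eq_idP pi (j : 'I_n) :
  reflect (forall c : 'I_n, c < j -> pi c < pi j) (code pi j == j :> nat).
Proof.
rewrite codeE.
have sub : smaller_before pi j \subset [set c : 'I_n | c < j].
  by apply/subsetP=> c; rewrite !inE => /andP[].
have -> : (#|smaller_before pi j| == j) =
          (smaller_before pi j == [set c : 'I_n | c < j]).
  rewrite -[X in _ == X]card_ord_lt eqEcard sub eqn_leq.
  by rewrite (subset_leq_card sub).
apply: (iffP eqP) => [/setP eqj c ltcj | max_j].
  by have := eqj c; rewrite !inE ltcj.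
by apply/setP=> c; rewrite !inE; case: ltnP => // /max_j.
Qed.

(** Since [pi i] is a left-to-right minimum, the only earlier value that can be alone below [pi j]
    is [pi i] itself. *)
Lemma code_eq1P pi (i j : 'I_n) : i.+1 = j -> code pi i == 0 :> nat ->
  reflect (pi i < pi j /\ forall c : 'I_n, c < i -> pi j < pi c)
          (code pi j == 1 :> nat).
Proof.
move=> ij /code_eq0P min_i; rewrite codeE.
have ltij : i < j by rewrite -ij.
apply: (iffP cards1P) => [[x Dx] | [lt_pi_ij above]].
  have /setP/(_ i) := Dx; have /setP/(_ x) := Dx.
  rewrite !inE eqxx ltij /= => /andP[ltxj lt_pi_xj].
  have -> : i = x.
    (* Otherwise [x] precedes [i], and [pi i < pi x < pi j] puts [i] in the singleton too. *)
    apply/eqP/contraT => neq_ix; have ltxi : x < i.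
      by move: neq_ix; rewrite -val_eqE /=; lia.
    have /setP/(_ i) := Dx; rewrite !inE ltij (negPf neq_ix) /=.
    by have := min_i x ltxi; lia.
  move=> _; split=> // c ltcx; have /setP/(_ c) := Dx; rewrite !inE.
  have neq_cx : c != x by rewrite -val_eqE ltn_eqF.
  have neq_cj : c != j by rewrite -val_eqE ltn_eqF // (ltn_trans ltcx).
  rewrite (negPf neq_cx) (ltn_trans ltcx ltxj) /=.
  by have := perm_val_neq pi neq_cj; lia.
exists i; apply/setP=> c; rewrite !inE -ij ltnS; apply/andP/eqP => [[] | -> //].
  rewrite leq_eqVlt => /orP[/eqP/val_inj // | /above]; lia.
Qed.

End Code.

(** * Occurrences of the two patterns in terms of the code *)

Section Occurrences.

Variables (n : nat) (pi : 'S_n).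

(** The value list is written out unsorted, which is right for the pattern 12, where
    [pi x < pi y]. *)
Definition box_empty (x y : 'I_n) (b : nat * nat) : bool :=
  [forall c : 'I_n,
    ~~ ((nth 0 [:: 0; x.+1; y.+1; n.+1] b.1 < c.+1 <
           nth 0 [:: 0; x.+1; y.+1; n.+1] b.1.+1) &&
        (nth 0 [:: 0; (pi x).+1; (pi y).+1; n.+1] b.2 < (pi c).+1 <
           nth 0 [:: 0; (pi x).+1; (pi y).+1; n.+1] b.2.+1))].

(** The bound on [s] makes every listed pair a genuine box: [boxes] would drop the others, while
    [all] would still test them. *)
Lemma mesh_occurrence12 (s : seq (nat * nat)) (x y : 'I_n) :
  all (fun b => (b.1 < 3) && (b.2 < 3)) s ->
  mesh_occurrence (1%g : 'S_2, boxes 2 s) pi [tuple x; y] =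
  [&& x < y, pi x < pi y & all (box_empty x y) s].
Proof.
move=> /allP bounded_s; rewrite /mesh_occurrence /=.
have -> : [forall i : 'I_2, forall j : 'I_2,
    (i < j) ==> (tnth [tuple x; y] i < tnth [tuple x; y] j)] = (x < y).
  apply/forallP/idP => [/(_ ord0)/forallP/(_ ord_max) // | ltxy i].
  apply/forallP=> j; apply/implyP.
  by case: i j => [[|[|i]] ?] [[|[|j]] ?].
have -> : [forall i : 'I_2, forall j : 'I_2,
    (pi (tnth [tuple x; y] i) < pi (tnth [tuple x; y] j)) ==
    ((1%g : 'S_2) i < (1%g : 'S_2) j)] = (pi x < pi y).
  apply/forallP/idP => [/(_ ord0)/forallP/(_ ord_max) /eqP | lt_pi i].
    by rewrite !perm1.
  apply/forallP=> j; rewrite !perm1.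
  by case: i j => [[|[|i]] ?] [[|[|j]] ?] //=;
    rewrite /tnth /= ?ltnn ?lt_pi // ltnNge ltnW.
case: (x < y) => //=; case: ltnP => //= lt_pi.
have sort_val : sort leq [:: (pi x).+1; (pi y).+1] = [:: (pi x).+1; (pi y).+1].
  by apply: sorted_sort; [exact: leq_trans | rewrite /= andbT; lia].
apply/forallP/allP => [empty b sb | empty b].
  have /andP[b1 b2] := bounded_s b sb.
  have := empty (Ordinal b1, Ordinal b2).
  rewrite inE /= -surjective_pairing sb => /forallP empty_b.
  apply/forallP=> c; have := empty_b c.
  by rewrite /in_box /mesh_pos /mesh_val /= sort_val.
apply/implyP; rewrite inE => /empty /forallP empty_b.
apply/forallP=> c; have := empty_b c.
by rewrite /in_box /mesh_pos /mesh_val /= sort_val.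
Qed.

(** The three boxes of column 1 together contain every point strictly between the positions [x] and
    [y]. *)
Lemma box_empty_column1 (x y : 'I_n) : x < y -> pi x < pi y ->
  reflect (x.+1 = y)
    [&& box_empty x y (1, 0), box_empty x y (1, 1) & box_empty x y (1, 2)].
Proof.
move=> ltxy lt_pi.
apply: (iffP and3P) => [[/forallP b0 /forallP b1 /forallP b2] | xy].
  apply/eqP; rewrite eqn_leq ltxy leqNgt; apply/negP => ltSxy.
  have ltSxn : x.+1 < n := ltn_trans ltSxy (ltn_ord y).
  (* The position right after [x] is the offending one: its value differs from [pi x] and [pi y], so
     it falls in one of the three boxes. *)
  pose c := Ordinal ltSxn; move: (b0 c) (b1 c) (b2 c) => /=.
  have neq_cx : c != x by rewrite -val_eqE /= gtn_eqF.
  have neq_cy : c != y by rewrite -val_eqE /= ltn_eqF.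
  have := perm_val_neq pi neq_cx; have := perm_val_neq pi neq_cy.
  have := ltn_ord (pi c); lia.
by split; apply/forallP=> c /=; lia.
Qed.

(** Column 1 forces adjacency; box (0,0) makes [pi x] a left-to-right minimum, and box (0,2) makes
    [pi y] a left-to-right maximum. *)
Lemma Nr23_occurrence (x y : 'I_n) :
  mesh_occurrence Nr23 pi [tuple x; y] =
  [&& x.+1 == y, code pi x == 0 :> nat & code pi y == y :> nat].
Proof.
rewrite mesh_occurrence12 //.
apply/idP/idP => [|/and3P[/eqP xy /code_eq0P min_x /code_eq_idP max_y]].
  rewrite [all _ _]/= andbT => /and5P[ltxy lt_pi /forallP b00 /forallP b02].
  move=> /(box_empty_column1 ltxy lt_pi) xy; apply/and3P; split.
  - exact/eqP.
  - apply/code_eq0P=> c ltcx; have := b00 c => /=.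
    by have := @perm_val_neq _ pi c x; rewrite -val_eqE ltn_eqF //=; lia.
  - apply/code_eq_idP=> c; rewrite -xy ltnS leq_eqVlt.
    case/orP=> [/eqP/val_inj -> // | ltcx]; have := b02 c => /=.
    have := ltn_ord (pi c); have := @perm_val_neq _ pi c y.
    by rewrite -val_eqE ltn_eqF ?(ltn_trans ltcx) //=; lia.
have ltxy : x < y by rewrite -xy.
have lt_pi := max_y x ltxy.
rewrite [all _ _]/= andbT; apply/and5P; split=> //.
- by apply/forallP=> c /=; have := min_x c; lia.
- by apply/forallP=> c /=; have := max_y c; lia.
- exact/box_empty_column1.
Qed.

(** Besides the adjacency, boxes (0,0) and (0,1) push every value left of [x] above [pi y], so only
    [pi x] is counted at [y]. *)
Lemma Nr24_occurrence (x y : 'I_n) :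
  mesh_occurrence Nr24 pi [tuple x; y] =
  [&& x.+1 == y, code pi x == 0 :> nat & code pi y == 1 :> nat].
Proof.
rewrite mesh_occurrence12 //.
apply/idP/idP => [|/and3P[/eqP xy e0 /(code_eq1P xy e0)[lt_pi above]]].
  rewrite [all _ _]/= andbT => /and5P[ltxy lt_pi /forallP b00 /forallP b01].
  move=> /(box_empty_column1 ltxy lt_pi) xy.
  have above (c : 'I_n) : c < x -> pi y < pi c.
    move=> ltcx; move: (b00 c) (b01 c) => /=.
    have neq_cx : c != x by rewrite -val_eqE ltn_eqF.
    have neq_cy : c != y by rewrite -val_eqE ltn_eqF // (ltn_trans ltcx).
    have := perm_val_neq pi neq_cx; have := perm_val_neq pi neq_cy; lia.
  have e0 : code pi x == 0 :> nat.
    by apply/code_eq0P=> c /above; apply: ltn_trans.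
  apply/and3P; split=> //; first exact/eqP.
  exact/(code_eq1P xy e0).
have ltxy : x < y by rewrite -xy.
rewrite [all _ _]/= andbT; apply/and5P; split=> //.
- by apply/forallP=> c /=; have := above c; lia.
- by apply/forallP=> c /=; have := above c; lia.
- exact/box_empty_column1.
Qed.

(** The first position of an occurrence is the predecessor of the second, so projecting to the
    second position is injective. *)
Lemma mesh_count_records (p : mesh_pattern 2) (t : nat -> nat) :
  (forall x y : 'I_n, mesh_occurrence p pi [tuple x; y] =
     [&& x.+1 == y, code pi x == 0 :> nat & code pi y == t y :> nat]) ->
  mesh_count p pi = #|records t (code pi)|.
Proof.
move=> occE; rewrite /mesh_count.
have tupleE (a : 2.-tuple 'I_n) : a = [tuple tnth a ord0; tnth a ord_max].
  by apply: eq_from_tnth => [[[|[|i]] lti]] //; congr (tnth a); apply: val_inj.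
rewrite -(@card_in_imset _ _ (fun a : 2.-tuple 'I_n => tnth a ord_max)).
  apply: eq_card => j; rewrite inE.
  apply/imsetP/existsP => [[a] | [i occ]].
    by rewrite inE {1}(tupleE a) occE => occ ->; exists (tnth a ord0).
  by exists [tuple i; j]; rewrite ?inE ?occE.
move=> a b; rewrite !inE {1}(tupleE a) {1}(tupleE b) !occE.
move=> /andP[/eqP xa _] /andP[/eqP xb _] eq1.
suff eq0 : tnth a ord0 = tnth b ord0 by rewrite (tupleE a) (tupleE b) eq0 eq1.
by apply: val_inj; apply: succn_inj; rewrite /= xa xb eq1.
Qed.

End Occurrences.

Theorem mainTheorem6 (n m : nat) (hn : 1 <= n) :
  #|[set pi : 'S_n | mesh_count Nr23 pi == m]| =
  #|[set pi : 'S_n | mesh_count Nr24 pi == m]|.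
Proof.
transitivity #|[set pi : 'S_n | #|records id (code pi)| == m]|.
  apply: eq_card => pi; rewrite !inE.
  congr (_ == m).
  exact: mesh_count_records (Nr23_occurrence pi).
transitivity #|[set pi : 'S_n | #|records (fun=> 1) (code pi)| == m]|; last first.
  apply: eq_card => pi; rewrite !inE.
  congr (_ == m).
  exact: esym (mesh_count_records (t := fun=> 1) (Nr24_occurrence pi)).
rewrite (card_code_preim (fun e => #|records id e| == m)).
rewrite (card_code_preim (fun e => #|records (fun=> 1) e| == m)).
(* The first set of codes is replaced by its image under the involution, which is also its
   preimage. *)
rewrite -(card_imset _ (can_inj (@swap_codeK n))).
apply: eq_card => e; rewrite (can2_imset_pre _ (@swap_codeK n) (@swap_codeK n)).
by rewrite !in_set swap_code_codes -records_swap_code swap_codeK.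
Qed.
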